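(* Let $d\geq 3$ be an integer and let $G$ be a connected $d$-regular graph of even order. Let $\lambda_{2}(G)$ denote the second largest eigenvalue of the adjacency matrix of $G$. Then $G$ contains $\left\lfloor\frac{2}{3}\,(d-\lambda_{2}(G))\right\rfloor$ pairwise edge-disjoint perfect matchings.
   Context: All graphs are finite, undirected and without loops or multiple edges. The order of a graph is its number of vertices. The eigenvalues of a graph $G$ of order $n$ are the eigenvalues of its adjacency matrix, listed with multiplicity as $\lambda_{1}(G)\geq\lambda_{2}(G)\geq\cdots\geq\lambda_{n}(G)$. A matching of $G$ is a set of pairwise disjoint edges of $G$; it is perfect if every vertex of $G$ is incident with some edge in it. *)

(* Defs.v *)
From HB Require Import structures.
From mathcomp Require Import all_boot all_order all_algebra reals polyrcf.
Set Implicit Arguments.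
Unset Strict Implicit.
Unset Printing Implicit Defensive.
Import Order.TTheory GRing.Theory Num.Theory.
Local Open Scope ring_scope.

Definition simple_graph (T : finType) (e : rel T) : Prop :=
  symmetric e /\ irreflexive e.

(* The graph with no vertices is not counted as connected. *)
Definition connected_graph (T : finType) (e : rel T) : Prop :=
  (0 < #|T|)%N /\ forall x y : T, connect e x y.

Definition regular_graph (T : finType) (e : rel T) (d : nat) : Prop :=
  forall x : T, #|[set y | e x y]| = d.

Definition edges (T : finType) (e : rel T) : {set {set T}} :=
  [set [set p.1; p.2] | p : T * T & e p.1 p.2].

Definition matching (T : finType) (e : rel T) (M : {set {set T}}) : Prop :=
  M \subset edges e /\ trivIset M.

Definition perfect_matching (T : finType) (e : rel T) (M : {set {set T}}) :
    Prop :=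
  matching e M /\ forall x : T, exists2 E, E \in M & x \in E.

Definition adjacency (R : realType) (T : finType) (e : rel T) : 'M[R]_#|T| :=
  \matrix_(i, j) (e (enum_val i) (enum_val j))%:R.

(* Real eigenvalues in nonincreasing order, each repeated according to its
   multiplicity as a root of the characteristic polynomial; rootsR lists every
   real root exactly once. *)
Definition eigenvalues (R : realType) (n : nat) (A : 'M[R]_n) : seq R :=
  sort (fun x y => y <= x)
    (flatten [seq nseq (mup x (char_poly A)) x | x <- rootsR (char_poly A)]).

Definition lambda2 (R : realType) (T : finType) (e : rel T) : R :=
  (eigenvalues (adjacency R e))`_1.

Lemma eigenvaluesE (R : realType) (n : nat) (A : 'M[R]_n) (s : seq R) :
  sorted (fun x y => y <= x) s -> char_poly A = \prod_(x <- s) ('X - x%:P) ->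
  eigenvalues A = s.
Proof.
move=> s_sorted chA.
have tot : total (fun x y : R => y <= x) by move=> x y; exact: le_total.
have tr : transitive (fun x y : R => y <= x).
  by move=> y x z yx zy; exact: le_trans zy yx.
have asym : antisymmetric (fun x y : R => y <= x).
  by move=> x y /andP[yx xy]; apply/le_anti; rewrite xy yx.
apply: (sorted_eq tr asym) => //; first exact: sort_sorted.
rewrite /eigenvalues perm_sort; set p := char_poly A.
have p0 : p != 0 by exact/monic_neq0/char_poly_monic.
have r_uniq : uniq (rootsR p) by exact: uniq_roots.
apply/allP => x _ /=; apply/eqP.
transitivity (mup x p); last by rewrite /p chA mu_prod_XsubC.
have cnt (r : seq R) : uniq r ->
    count_mem x (flatten [seq nseq (mup y p) y | y <- r]) =
      ((x \in r) * mup x p)%N.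
  elim: r => [|y r IHr] //= /andP[yr /IHr IH].
  rewrite count_cat count_nseq {}IH in_cons /= (eq_sym x y).
  case: eqVneq => [<-|_]; last by rewrite mul0n add0n.
  by rewrite (negPf yr) mul0n addn0.
rewrite cnt // -(roots_on_rootsR p0) in_itv /=.
by case: (boolP (root p x)) => [_|/mupNroot ->]; rewrite ?mul1n ?muln0.
Qed.

(* Main.v *)
Require Import Defs.
From mathcomp Require Import all_boot all_order all_algebra reals.
From mathcomp Require Import complex polyrcf zify ring lra.
Set Implicit Arguments.
Unset Strict Implicit.
Unset Printing Implicit Defensive.
Import Order.TTheory GRing.Theory Num.Theory.

(** Write n for the number of vertices, k for the floor in the statement, and
e(X) for the number of edges leaving a vertex set X.  Testing the quadratic
form of the adjacency matrix on the vector n 1_X - |X| 1, which is orthogonal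
to the all-ones eigenvector, gives (d - lambda2) |X| (n - |X|) <= n e(X)
([edge_expansion]).  As k <= 2/3 (d - lambda2), every X with |X| <= n/3 has
e(X) >= k |X|, strictly if |X| < n/3; this is the origin of the constant 2/3,
since n / (n - |X|) is at most 3/2 exactly when |X| <= n/3.  From here on only
this expansion matters.

The matchings are found one at a time.  Suppose that m < k disjoint perfect
matchings M_i have been removed, leaving an r-regular graph h.  Removing them
costs a set X at most m |X| of its boundary, so h still has at least |X| edges
leaving every X with |X| <= n/3.  If h has no perfect matching, Tutte's theorem
([tutte]) gives a set S and at least |S| + 2 disjoint odd sets with no edges
between them outside S.  The edges from these odd sets all end in S, so there
are at most r |S| of them, and at least two of the odd sets are light: fewer
than r edges leave them.  A light set X has more than r vertices, since a
smaller one sends too many edges out; hence X has fewer than |X| leaving edges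
and |X| > n/3.  So there are exactly two light sets, and equality in the count
shows that no edge of h leaves them.  Thus h splits into two odd sides Q and
its complement, each with more than n/3 vertices ([perfect_or_split]).

In the split case extending the given matchings may be impossible (K_10 minus
five perfect matchings can be two disjoint copies of K_5), so one of them has
to be replaced.  The same count shows that each side minus any one of its
vertices has a perfect matching in h ([split_factor_critical]), and expansion
of Q shows that some M_i has two edges u w and u' w' between the sides
([crossing_twice]).  Let N consist of the edge u w and of perfect matchings of
Q - u and of its complement minus w in h, and let N take the place of M_i.  If
the new leftover graph splits again, into P and its complement, then an edge
of the original graph between two of the four sets in which P and Q cut the
vertices is in N or in some M_j.  Each of these sets X therefore has
e(X) <= (m + 1) |X|, so it is empty or has at least n/3 vertices
([split_part_large]).  As P, Q and their complements all have more than n/3 and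
so fewer than 2n/3 vertices, {P, complement of P} = {Q, complement of Q}.  But
u' w' is an edge of the new leftover graph between the two sides of Q, a
contradiction; so the new matchings can be extended. *)

(** * Tutte's theorem on a set of vertices *)

Lemma even_card_involution (T : finType) (f : T -> T) (K : {set T}) :
  (forall x, x \in K -> [/\ f (f x) = x, f x != x & f x \in K]) ->
  ~~ odd #|K|.
Proof.
elim: {K}_.+1 {-2}K (ltnSn #|K|) => // k IH K leK fK.
have [->|[x xK]] := set_0Vmem K; first by rewrite cards0.
have [ffx fx fxK] := fK _ xK.
have sub : [set x; f x] \subset K.
  by apply/subsetP => y; rewrite !inE => /orP[] /eqP->.
have c2 : #|[set x; f x]| = 2 by rewrite cards2 eq_sym fx.
have := cardsID [set x; f x] K; rewrite (setIidPr sub) c2 => <-.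
rewrite oddD /= IH //.
  by rewrite cardsD (setIidPr sub) c2; have := subset_leq_card sub; lia.
move=> y; rewrite !inE negb_or => /andP[/andP[yx yfx] yK].
have [ffy fy fyK] := fK _ yK; split=> //; rewrite fyK andbT negb_or.
apply/andP; split; first by apply: contraNneq yfx => <-; rewrite ffy.
by apply: contraNneq yx => /(congr1 f); rewrite ffy ffx => ->.
Qed.

Section TutteBerge.
Variables (T : finType) (h : rel T).
Hypotheses (h_sym : symmetric h) (h_irr : irreflexive h).

(** A matching inside W is encoded as an involution whose fixed points are the
    vertices that it misses; changing it locally means redefining a function. *)
Definition pairing (W : {set T}) (f : {ffun T -> T}) : bool :=
  [forall x, (f (f x) == x) &&
     ((f x == x) || [&& h x (f x), x \in W & f x \in W])].

Definition covered (f : {ffun T -> T}) : {set T} := [set x | f x != x].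

Definition maximum_pairing (W : {set T}) (f : {ffun T -> T}) : bool :=
  pairing W f && [forall g, pairing W g ==> (#|covered g| <= #|covered f|)].

Lemma pairingP (W : {set T}) (f : {ffun T -> T}) :
  reflect (forall x, f (f x) = x /\
             (f x != x -> [/\ h x (f x), x \in W & f x \in W]))
          (pairing W f).
Proof.
apply: (iffP forallP) => fP x.
  have /andP[/eqP ff fx] := fP x; split=> // nfx.
  by move: fx; rewrite (negPf nfx) => /and3P[].
have [-> imp] := fP x; rewrite eqxx /=.
by case: eqVneq imp => //= _ /(_ isT)[-> -> ->].
Qed.

Lemma maximum_pairingP W f :
  reflect (pairing W f /\ forall g, pairing W g -> #|covered g| <= #|covered f|)
          (maximum_pairing W f).
Proof.
apply: (iffP andP) => -[pf].
  by move=> /forallP mf; split=> // g; exact/implyP.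
by move=> mf; split=> //; apply/forallP => g; apply/implyP/mf.
Qed.

Lemma maximum_pairing_exists W : exists f, maximum_pairing W f.
Proof.
have p0 : pairing W [ffun x => x].
  by apply/pairingP => x; rewrite !ffunE eqxx.
case: (arg_maxnP (fun f => #|covered f|) p0) => f pf mf.
by exists f; apply/maximum_pairingP.
Qed.

Lemma even_covered W f : pairing W f -> ~~ odd #|covered f|.
Proof.
move=> /pairingP fP; apply: (even_card_involution (f := f)) => x.
rewrite !inE => nfx; have [ff _] := fP x; split=> //.
by rewrite ff eq_sym.
Qed.

Lemma covered_sub W f : pairing W f -> covered f \subset W.
Proof.
move=> /pairingP fP; apply/subsetP => x; rewrite !inE => nfx.
by have [_ /(_ nfx)[]] := fP x.
Qed.

(* swap: rematch x with y, releasing z = f y *)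
(** Adds the edge x y to the matching f, releasing the former partner of y.
    When f misses x but covers y this keeps the number of covered vertices. *)
Definition rematch (f : {ffun T -> T}) (x y : T) : {ffun T -> T} :=
  [ffun w => if w == x then y else if w == y then x
             else if w == f y then w else f w].

Lemma pairing_rematch W f x y : pairing W f -> f x = x -> h x y ->
  x \in W -> y \in W -> pairing W (rematch f x y).
Proof.
move=> /pairingP fP fx hxy xW yW.
have nxy : x != y by apply: contraTneq hxy => ->; rewrite h_irr.
have [ffy _] := fP y.
apply/pairingP => w; rewrite !ffunE.
have [->|nwx] := eqVneq w x.
  by rewrite eqxx eq_sym (negPf nxy).
have [->|nwy] := eqVneq w y.
  by rewrite eqxx; split=> // _; rewrite h_sym.
have [wz|nwz] := eqVneq w (f y).
  by rewrite -?wz ?eqxx ?(negPf nwx) ?(negPf nwy) ?eqxx.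
have [ffw fw] := fP w.
have -> : (f w == x) = false.
  by apply: contraNF nwx => /eqP E; rewrite -ffw E fx.
have -> : (f w == y) = false.
  by apply: contraNF nwz => /eqP <-; rewrite ffw.
have -> : (f w == f y) = false.
  by apply: contraNF nwy => /eqP E; rewrite -ffw E ffy.
by rewrite ffw.
Qed.

Lemma covered_rematch W f x y : pairing W f -> f x = x -> x != y ->
  covered (rematch f x y) = x |: (y |: covered f :\ f y).
Proof.
move=> /pairingP fP fx nxy; have [ffy _] := fP y.
apply/setP => w; rewrite !inE !ffunE.
have [->|nwx] := eqVneq w x; first by rewrite eq_sym nxy.
have [->|nwy] := eqVneq w y; first by rewrite nxy.
by case: (eqVneq w (f y)) => //=; rewrite eqxx.
Qed.

Lemma maximum_no_free_edge W f x y : maximum_pairing W f -> h x y ->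
  x \in W -> y \in W -> f x = x -> f y = y -> False.
Proof.
move=> /maximum_pairingP[pf mf] hxy xW yW fx fy.
have nxy : x != y by apply: contraTneq hxy => ->; rewrite h_irr.
have := mf _ (pairing_rematch pf fx hxy xW yW).
rewrite (covered_rematch pf fx nxy) fy.
rewrite (_ : covered f :\ y = covered f).
  by rewrite !cardsU1 !inE fx fy eqxx negb_or nxy /=; lia.
apply/setP => w; rewrite !inE; case: eqVneq => //= ->; by rewrite fy eqxx.
Qed.

Lemma maximum_rematch W f x y : maximum_pairing W f -> h x y ->
  x \in W -> y \in W -> f x = x -> maximum_pairing W (rematch f x y).
Proof.
move=> mf hxy xW yW fx.
have nfy : f y != y.
  by apply/eqP => fy; exact: (maximum_no_free_edge mf hxy xW yW fx fy).
have /maximum_pairingP[pf mx] := mf.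
have nxy : x != y by apply: contraTneq hxy => ->; rewrite h_irr.
apply/maximum_pairingP; split; first exact: pairing_rematch.
move=> g /mx /leq_trans; apply.
rewrite (covered_rematch pf fx nxy) cardsU1 !inE (negPf nxy) fx eqxx.
rewrite andbF /= add1n.
have yin : y \in covered f :\ f y by rewrite !inE eq_sym nfy.
have -> : y |: covered f :\ f y = covered f :\ f y.
  by apply/setUidPr; rewrite sub1set.
have /pairingP/(_ y)[ffy _] := pf.
have fyin : f y \in covered f by rewrite inE ffy eq_sym.
by rewrite (cardsD1 (f y) (covered f)) fyin.
Qed.

Definition inner (W : {set T}) : rel T :=
  [rel x y | [&& h x y, x \in W & y \in W]].

(** Gallai's lemma: if no vertex of W is covered by all maximum matchings, then
    a maximum matching misses at most one vertex of each component of W.  By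
    induction on the length of a path from u to v: an inner vertex t of the path
    is missed by some maximum matching g, which must cover u and v by induction;
    if g is chosen to agree with f as much as possible, shifting one of its
    edges towards f gives a contradiction. *)
Lemma gallai_missed_unique (W : {set T}) :
  (forall v, v \in W -> exists2 f, maximum_pairing W f & f v = v) ->
  forall f u v, maximum_pairing W f -> f u = u -> f v = v ->
    connect (inner W) u v -> u = v.
Proof.
move=> missed f u v mf fu fv /connectP[p].
move=> pth vE; have [//|nuv] := eqVneq u v; exfalso; move: pth vE nuv.
elim: {p}_.+1 {-2}p (ltnSn (size p)) f u v mf fu fv => // k IH p lep.
move=> f u v mf fu fv + + nuv.
case: p lep => [|t p] /= lep; first by move=> _ vu; rewrite vu eqxx in nuv.
move=> /andP[/and3P[hut uW tW] pth] vE.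
have [tv|ntv] := eqVneq t v.
  case: (maximum_no_free_edge mf hut uW tW fu _); by rewrite tv.
have [g0 mg0 g0t] := missed _ tW.
pose Q g := maximum_pairing W g && (g t == t).
have Qg0 : Q g0 by rewrite /Q mg0 g0t eqxx.
(* g misses t and, among such pairings, agrees with f as often as possible *)
case: (arg_maxnP (fun g : {ffun T -> T} => #|[set w | f w == g w]|) Qg0).
move=> g /andP[mg /eqP gt] agree.
have gu : g u != u.
  by apply/eqP => gu; exact: (maximum_no_free_edge mg hut uW tW gu gt).
have gv : g v != v.
  by apply/eqP => gv; exact: (IH p _ g t v mg gt gv pth vE).
have /maximum_pairingP[pf mxf] := mf.
have /maximum_pairingP[pg mxg] := mg.
have cardfg : #|covered f| = #|covered g|.
  by apply/eqP; rewrite eqn_leq mxf ?mxg.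
(* f and g cover equally many vertices and g covers u and v, which f misses;
   so f covers two vertices that g misses, one of which is not t. *)
have [x] : exists x, x \in (covered f :\: covered g) :\ t.
  apply/set0Pn; rewrite -card_gt0.
  have sub : [set u; v] \subset covered g :\: covered f.
    by apply/subsetP => w; rewrite !inE => /orP[]/eqP->; rewrite ?fu ?fv eqxx.
  have : 1 < #|covered f :\: covered g|.
    rewrite cardsD cardfg setIC -cardsD; apply: leq_trans (subset_leq_card sub).
    by rewrite cards2 nuv.
  by rewrite (cardsD1 t); case: (t \in _) => //; apply: ltnW.
rewrite !inE negbK => /and3P[nxt /eqP gx nfx].
have /pairingP fP := pf; have /pairingP gP := pg.
have [ffx /(_ nfx)[hxy xW yW]] := fP x.
(* Moving the edge of f at x into g increases the agreement of g with f. *)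
set y := f x in ffx hxy yW nfx.
have nyt : y != t.
  apply/eqP => yt; apply: (maximum_no_free_edge mg hxy xW yW gx).
  by rewrite yt.
have [ggy _] := gP y.
have mg' := maximum_rematch mg hxy xW yW gx.
have Qg' : Q (rematch g x y).
  rewrite /Q mg' ffunE (eq_sym t) (negPf nxt) (eq_sym t) (negPf nyt).
  by case: (t == g y); rewrite ?gt eqxx.
have /= := agree _ Qg'; rewrite leqNgt => /negP; apply.
rewrite [X in _ < X](cardsD1 x) !inE ffunE eqxx -/y eqxx add1n ltnS.
apply: subset_leq_card; apply/subsetP => w; rewrite !inE ffunE => /eqP fwgw.
have nwx : w != x by apply: contraNneq nfx => wx; rewrite -/y -gx -wx -fwgw wx.
rewrite nwx (negPf nwx) /=.
have nwy : w != y.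
  apply: contraNneq nfx => wy; move: fwgw; rewrite wy ffx => xgy.
  by rewrite -/y -ggy -xgy gx.
rewrite (negPf nwy); case: (eqVneq w (g y)) => [wgy|_]; last by rewrite fwgw.
have fwy : f w = y by rewrite fwgw wgy ggy.
have [ffw _] := fP w.
by move: nwx; rewrite -ffw fwy ffx eqxx.
Qed.

(** The nontrivial half of the Tutte-Berge formula.  A vertex covered by all
    maximum matchings can be moved into S; when there is none, Gallai's lemma
    applies with S empty, and each component with a missed vertex is odd because
    its other vertices are matched among themselves. *)
Theorem tutte_berge (W : {set T}) (f : {ffun T -> T}) : maximum_pairing W f ->
  exists (S : {set T}) (P : {set {set T}}),
  [/\ S \subset W, trivIset P,
      forall X, X \in P -> [/\ odd #|X|, X \subset W :\: S &
        forall x y, x \in X -> y \in W :\: S -> h x y -> y \in X]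
    & #|W :\: covered f| + #|S| <= #|P|].
Proof.
elim: {W}_.+1 {-2}W (ltnSn #|W|) f => // k IH W leW f mf.
have /maximum_pairingP[pf mxf] := mf.
have [/existsP[v /andP[vW /forallP always]]|/existsPn sometimes] :=
  boolP [exists v in W, [forall g, maximum_pairing W g ==> (g v != v)]].
  have [f' mf'] := maximum_pairing_exists (W :\ v).
  have ltW : #|W :\ v| < k by move: leW; rewrite (cardsD1 v W) vW.
  have [S [P [SW tP PX cP]]] := IH _ ltW _ mf'.
  have vS : v \notin S by apply/negP => /(subsetP SW); rewrite !inE eqxx.
  exists (v |: S), P; rewrite -setDDl; split=> //.
    by rewrite subUset sub1set vW (subset_trans SW) ?subsetDl.
  rewrite cardsU1 vS.
  have /maximum_pairingP[pf' _] := mf'.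
  have pf'W : pairing W f'.
    have /pairingP fP := pf'; apply/pairingP => x; have [ffx fx] := fP x.
    by split=> // /fx[-> ]; rewrite !inE => /andP[_ ->] /andP[_ ->].
  have f'v : f' v = v.
    have /pairingP/(_ v)[_ fv] := pf'.
    by apply/eqP/negPn/negP => /fv[_]; rewrite !inE eqxx.
  have lt_cov : #|covered f'| < #|covered f|.
    rewrite ltnNge; apply/negP => le; have := always f'.
    rewrite f'v eqxx implybF => /negP; apply.
    by apply/maximum_pairingP; split=> // g /mxf /leq_trans; apply.
  have ev := even_covered pf; have ev' := even_covered pf'.
  have cW := cardsID (covered f) W; have cW' := cardsID (covered f') (W :\ v).
  rewrite (setIidPr (covered_sub pf)) in cW.
  rewrite (setIidPr (covered_sub pf')) in cW'.
  rewrite (cardsD1 v W) vW in cW.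
  move: ev ev' cW cW' cP lt_cov; clear.
  move: #|covered f'| #|covered f| #|W :\ v| #|W :\: _| #|W :\ v :\: _|.
  by move: #|S| #|P| => *; lia.
have missed v : v \in W -> exists2 g, maximum_pairing W g & g v = v.
  move=> vW; have := sometimes v; rewrite vW /= negb_forall => /existsP[g].
  by rewrite negb_imply negbK => /andP[mg /eqP gv]; exists g.
have conn_sym : connect_sym (inner W).
  by apply: sym_connect_sym => x y; rewrite /inner /= h_sym (andbC (x \in W)).
pose K u := [set x in W | connect (inner W) u x].
have fixed u : u \in W :\: covered f -> f u = u /\ u \in W.
  by rewrite !inE negbK => /andP[/eqP].
have uK u : u \in W -> u \in K u by move=> uW; rewrite inE uW connect0.
exists set0, (K @: (W :\: covered f)); split; first exact: sub0set.
- apply/trivIsetP => _ _ /imsetP[u uU ->] /imsetP[v vU ->] nK.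
  rewrite -setI_eq0; apply/set0Pn => -[x].
  rewrite !inE => /andP[/andP[_ ux] /andP[_ vx]].
  case/negP: nK; apply/eqP; congr K.
  have [[fu _] [fv _]] := (fixed _ uU, fixed _ vU).
  apply: (gallai_missed_unique missed mf fu fv); apply: connect_trans ux _.
  by rewrite conn_sym.
- move=> _ /imsetP[u uU ->]; have [fu uW] := fixed _ uU; split.
  + rewrite (cardsD1 u) uK //=; apply: (even_card_involution (f := f)) => x.
    have /pairingP/(_ x)[ffx fx] := pf.
    rewrite !inE => /and3P[nxu xW ux].
    have nfx : f x != x.
      apply: contraNneq nxu => fxx; apply/eqP/esym.
      exact: (gallai_missed_unique missed mf fu fxx ux).
    have [hx _ fxW] := fx nfx; split=> //; rewrite fxW.
    apply/andP; split.
      by apply: contraNneq nxu => /(congr1 f); rewrite ffx fu => ->.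
    by apply: connect_trans ux _; apply: connect1; rewrite /inner /= hx xW.
  + by apply/subsetP => x; rewrite !inE => /andP[-> _].
  + move=> x y; rewrite !inE => /andP[xW ux] /andP[_ yW] hxy; rewrite yW.
    by apply: connect_trans ux _; apply: connect1; rewrite /inner /= hxy xW.
- rewrite cards0 addn0 card_in_imset // => u v uU vU Kuv.
  have [[fu uW] [fv vW]] := (fixed _ uU, fixed _ vU).
  apply: (gallai_missed_unique missed mf fu fv).
  by have := uK _ vW; rewrite -Kuv inE vW.
Qed.

(** Parity improves the bound |S| < |P| to |S| + 2 <= |P|. *)
Corollary tutte (W : {set T}) : ~~ odd #|W| ->
  (exists2 f, pairing W f & forall x, x \in W -> f x != x) \/
  exists (S : {set T}) (P : {set {set T}}),
  [/\ S \subset W, trivIset P,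
      forall X, X \in P -> [/\ odd #|X|, X \subset W :\: S &
        forall x y, x \in X -> y \in W :\: S -> h x y -> y \in X]
    & #|S|.+2 <= #|P|].
Proof.
move=> evenW; have [f mf] := maximum_pairing_exists W.
have /maximum_pairingP[pf _] := mf.
have [full|/subsetPn[x xW nx]] := boolP (W \subset covered f).
  by left; exists f => // x /(subsetP full); rewrite inE.
right; have [S [P [SW tP PX cP]]] := tutte_berge mf.
exists S, P; split=> //; apply: leq_trans cP.
have := cardsID (covered f) W; rewrite (setIidPr (covered_sub pf)).
have : 0 < #|W :\: covered f| by apply/card_gt0P; exists x; rewrite inE nx.
have := even_covered pf; move: evenW.
move: #|W| #|covered f| #|W :\: _| #|S| => *; lia.
Qed.

End TutteBerge.

(** * Odd barriers in expanding regular graphs *)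

Definition cut (T : finType) (e : rel T) (A B : {set T}) : nat :=
  \sum_(x in A) #|[set y in B | e x y]|.

Section Cut.
Variables (T : finType) (h : rel T).

Lemma cut_eq0 (X : {set T}) :
  reflect (forall x y, x \in X -> y \notin X -> ~~ h x y) (cut h X (~: X) == 0).
Proof.
rewrite sum_nat_eq0; apply: (iffP forall_inP) => [c0 x y xX yX|c0 x xX].
  have /eqP/cards0_eq/setP/(_ y) := c0 x xX.
  by rewrite !inE yX /= => ->.
rewrite cards_eq0; apply/eqP/setP => y; rewrite !inE.
by apply/negP => /andP[yX]; apply/negP/c0.
Qed.

Lemma cut_sym (A B : {set T}) : symmetric h -> cut h A B = cut h B A.
Proof.
move=> h_sym; rewrite /cut.
under eq_bigr do rewrite -sum1_card.
under [RHS]eq_bigr do rewrite -sum1_card.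
rewrite (exchange_big_dep (mem B)) /=; last first.
  by move=> x y _; rewrite inE => /andP[].
apply: eq_bigr => y yB; apply: eq_bigl => x.
by rewrite !inE yB h_sym.
Qed.

Lemma cut_le_add (e : rel T) (A B : {set T}) (N : T -> {set T}) (k : nat) :
  (forall x y, x \in A -> y \in B -> e x y -> h x y || (y \in N x)) ->
  (forall x, #|N x| <= k) -> cut e A B <= cut h A B + k * #|A|.
Proof.
move=> eN Nk; rewrite mulnC -sum_nat_const -big_split /=.
apply: leq_sum => x xA; apply: leq_trans (leq_add (leqnn _) (Nk x)).
apply: leq_trans (leq_card_setU _ _); apply: subset_leq_card.
apply/subsetP => y; rewrite !inE => /andP[yB exy]; rewrite yB /=.
exact: eN.
Qed.

End Cut.

Section RegularBarrier.
Variables (T : finType) (h : rel T) (r : nat).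
Hypotheses (h_sym : symmetric h) (h_irr : irreflexive h).
Hypotheses (h_reg : regular_graph h r) (r_gt0 : 0 < r).
Hypothesis h_exp :
  forall X : {set T}, 3 * #|X| <= #|T| -> #|X| <= cut h X (~: X).

(** A vertex of X has at most |X| - 1 neighbours in X, so a set with at most r
    vertices has at least |X| (r + 1 - |X|) >= r leaving edges. *)
Lemma light_large (X : {set T}) : 0 < #|X| -> cut h X (~: X) < r -> r < #|X|.
Proof.
move=> X_gt0 lt_r; rewrite ltnNge; apply/negP => leX.
have : \sum_(x in X) (r.+1 - #|X|) <= cut h X (~: X).
  apply: leq_sum => x xX; rewrite leq_subLR -(h_reg x).
  rewrite -(cardsID X [set y | h x y]).
  have -> : [set y in ~: X | h x y] = [set y | h x y] :\: X.
    by apply/setP => y; rewrite !inE.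
  rewrite -addSn leq_add2r (cardsD1 x X) xX ltnS.
  apply: subset_leq_card; apply/subsetP => y; rewrite !inE => /andP[hxy ->].
  by rewrite andbT; apply: contraTneq hxy => ->; rewrite h_irr.
rewrite sum_nat_const; move: X_gt0 lt_r leX; clear.
move: #|X| (cut _ _ _) => a c *; nia.
Qed.

(** Each leaving edge of a member of P ends in S, and S absorbs at most r edges
    per vertex. *)
Lemma barrier_cut (S : {set T}) (P : {set {set T}}) : trivIset P ->
  (forall X x y, X \in P -> x \in X -> y \notin X -> h x y -> y \in S) ->
  \sum_(X in P) cut h X (~: X) <= r * #|S|.
Proof.
move=> tP closed.
apply: (@leq_trans (\sum_(X in P) cut h S X)).
  apply: leq_sum => X XP; rewrite (cut_sym S X h_sym); apply: leq_sum => x xX.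
  apply: subset_leq_card; apply/subsetP => y; rewrite !inE => /andP[yX hxy].
  by rewrite hxy andbT; exact: (closed X x y).
rewrite exchange_big mulnC -sum_nat_const /=; apply: leq_sum => s _.
rewrite -(h_reg s); under eq_bigr do rewrite -sum1_card.
rewrite (eq_bigr (fun X : {set T} => \sum_(y in X) (h s y : nat))); last first.
  move=> X _; rewrite [RHS]big_mkcond [LHS]big_mkcond; apply: eq_bigr => y _.
  by rewrite inE; case: (y \in X); case: (h s y).
rewrite -(big_trivIset _ tP) -sum1_card.
rewrite [X in X <= _]big_mkcond [X in _ <= X]big_mkcond.
by apply: leq_sum => y _; rewrite inE; case: (y \in _); case: (h s y).
Qed.

Definition light (P : {set {set T}}) : {set {set T}} :=
  [set X in P | cut h X (~: X) < r].

(** Members of P that are not light send at least r edges each to S, so at most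
    |S| of them exist; if there are exactly |S|, they use up all edges at S and
    nothing is left for the light ones. *)
Lemma barrier_light (S : {set T}) (P : {set {set T}}) : trivIset P ->
  (forall X x y, X \in P -> x \in X -> y \notin X -> h x y -> y \in S) ->
  #|P| <= #|S| + #|light P| /\
  (#|S| + #|light P| <= #|P| -> forall X, X \in light P -> cut h X (~: X) = 0).
Proof.
move=> tP closed; have := barrier_cut tP closed.
have lightP : light P \subset P by apply/subsetP => X; rewrite inE => /andP[].
rewrite (big_setID (light P)) (setIidPr lightP) /=.
have heavy : r * #|P :\: light P| <= \sum_(X in P :\: light P) cut h X (~: X).
  rewrite mulnC -sum_nat_const; apply: leq_sum => X.
  by rewrite !inE => /andP[+ XP]; rewrite XP -leqNgt.
have := cardsID (light P) P; rewrite (setIidPr lightP).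
move: heavy r_gt0; clear -lightP.
set c := \sum_(X in P :\: _) _; set l := \sum_(X in light P) _.
move=> heavy r0 cP le.
have leS : r * #|P :\: light P| <= r * #|S|.
  exact: leq_trans heavy (leq_trans (leq_addl _ _) le).
rewrite leq_pmul2l // in leS.
rewrite -cP (addnC #|S|) !leq_add2l; split=> // le2 X XL.
have : l == 0.
  have eqS : #|P :\: light P| = #|S| by apply/eqP; rewrite eqn_leq leS.
  rewrite -leqn0 -(leq_add2r c) add0n; apply: leq_trans le _.
  by rewrite -eqS.
by rewrite sum_nat_eq0 => /forall_inP/(_ X XL)/eqP.
Qed.

Lemma light_gt_third (P : {set {set T}}) X :
  X \in light P -> 0 < #|X| -> #|T| < 3 * #|X|.
Proof.
rewrite inE => /andP[_ lt_r] X0; rewrite ltnNge; apply/negP => /h_exp.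
by have := light_large X0 lt_r; lia.
Qed.

(** As a light set has more than n/3 vertices, at most two fit into T, and at
    most one fits into a set with fewer than 2n/3 vertices. *)
Lemma card_light (P : {set {set T}}) (U : {set T}) : trivIset P ->
  (forall X, X \in P -> 0 < #|X| /\ X \subset U) ->
  #|light P| * #|T|.+1 <= 3 * #|U|.
Proof.
move=> tP PU.
apply: (@leq_trans (3 * \sum_(X in P) #|X|)).
  rewrite big_distrr /= (big_setID (light P)) /= (setIidPr _); last first.
    by apply/subsetP => X; rewrite inE => /andP[].
  rewrite -sum_nat_const; apply: leq_trans (leq_addr _ _).
  apply: leq_sum => X XL; apply: (light_gt_third XL).
  by move: XL; rewrite inE => /andP[/PU[]].
rewrite leq_mul2l /= (eqP tP); apply: subset_leq_card.
by apply/bigcupsP => X /PU[].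
Qed.

(** Tutte's theorem yields at least two light sets, and there is room for only
    two; so they have no leaving edges at all. *)
Lemma perfect_or_split : ~~ odd #|T| ->
  (exists2 f : {ffun T -> T}, involutive f & forall x, h x (f x)) \/
  exists Q : {set T}, [/\ odd #|Q|, #|T| < 3 * #|Q|, #|T| < 3 * #|~: Q|
    & forall x y, x \in Q -> y \notin Q -> ~~ h x y].
Proof.
rewrite -cardsT => evT; have [[f /pairingP pf nf]|] := tutte h_sym h_irr evT.
  by left; exists f => x; have [fK fx] := pf x => //; case: fx; rewrite ?nf.
move=> [S [P [_ tP PX cP]]]; right; rewrite cardsT.
have PX0 X : X \in P -> 0 < #|X| /\ X \subset [set: T].
  by move=> /PX[oX _ _]; rewrite subsetT; split=> //; case: #|X| oX.
have closed X x y : X \in P -> x \in X -> y \notin X -> h x y -> y \in S.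
  move=> /PX[_ _ cl] xX yX hxy; apply: contraNT yX => yS.
  by apply: (cl x y xX _ hxy); rewrite !inE yS.
have := card_light tP PX0; rewrite cardsT => le2.
have [le1 zero] := barrier_light tP closed.
have lP : #|light P| = 2.
  move: le2 le1 cP; clear; move: #|light P| #|T| #|P| #|S| => *; nia.
have /card_gt1P[X [Y [XL YL nXY]]] : 1 < #|light P| by rewrite lP.
have XP : X \in P by move: XL; rewrite inE => /andP[].
have YP : Y \in P by move: YL; rewrite inE => /andP[].
exists X; split; first by have [] := PX _ XP.
- by apply: (light_gt_third XL); have [] := PX0 _ XP.
- apply: leq_trans (light_gt_third YL _) _; first by have [] := PX0 _ YP.
  rewrite leq_mul2l; apply: subset_leq_card; rewrite subsets_disjoint setCK.
  by rewrite disjoint_sym; move/trivIsetP: tP; apply.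
- by apply/cut_eq0/eqP; apply: zero => //; rewrite lP addn2.
Qed.

(** A Tutte barrier S for Q minus u becomes, with u added, a barrier of h
    exceeded by at least one odd set.  So there is a light set, and Q has room
    for only one; it has no leaving edges.  Its complement in Q contains u,
    has no leaving edges either and fewer than n/3 vertices; this contradicts
    expansion. *)
Lemma split_factor_critical (Q : {set T}) (u : T) : odd #|Q| ->
  #|T| < 3 * #|~: Q| -> (forall x y, x \in Q -> y \notin Q -> ~~ h x y) ->
  u \in Q ->
  exists2 f, pairing h (Q :\ u) f & forall x, x \in Q :\ u -> f x != x.
Proof.
move=> oQ Q_small noQ uQ.
have evW : ~~ odd #|Q :\ u| by move: oQ; rewrite (cardsD1 u) uQ.
have [//|] := tutte h_sym h_irr evW.
move=> [S [P [SW tP PX cP]]]; exfalso.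
have PX0 X : X \in P -> 0 < #|X| /\ X \subset Q.
  move=> /PX[oX XW _]; split; first by case: #|X| oX.
  by apply: subset_trans XW _; rewrite setDDl subsetDl.
have closed X x y : X \in P -> x \in X -> y \notin X -> h x y -> y \in u |: S.
  move=> XP xX yX hxy; have [_ _ cl] := PX _ XP; apply: contraNT yX.
  rewrite !inE negb_or => /andP[yu yS].
  apply: (cl x y xX _ hxy); rewrite !inE yu yS /=.
  apply/negPn/negP => yQ; have [_ /subsetP XQ] := PX0 _ XP.
  by have := noQ _ _ (XQ _ xX) yQ; rewrite hxy.
have uS : u \notin S by apply/negP => /(subsetP SW); rewrite !inE eqxx.
have le2 := card_light tP PX0.
have [le1 zero] := barrier_light tP closed.
have QC := cardsC Q.
rewrite cardsU1 uS in le1 zero.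
have lP : #|light P| = 1.
  move: le2 le1 cP Q_small QC; clear.
  move: #|light P| #|T| #|P| #|S| #|Q| #|~: Q| => *; nia.
have /card_gt0P[X XL] : 0 < #|light P| by rewrite lP.
have XP : X \in P by move: XL; rewrite inE => /andP[].
have [X_gt0 XQ] := PX0 _ XP; have [_ XW _] := PX _ XP.
have /cut_eq0 noX : cut h X (~: X) == 0.
  by apply/eqP/zero => //; rewrite lP; move: cP; lia.
have := light_gt_third XL X_gt0.
have uX : u \notin X by apply/negP => /(subsetP XW); rewrite !inE eqxx andbF.
have := cardsID X Q; rewrite (setIidPr XQ) => QX X_large.
have : #|Q :\: X| <= cut h (Q :\: X) (~: (Q :\: X)).
  apply: h_exp; move: QX X_large Q_small QC; clear.
  move: #|T| #|X| #|Q| #|~: Q| #|Q :\: X| => *; lia.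
have /eqP-> : cut h (Q :\: X) (~: (Q :\: X)) == 0.
  apply/cut_eq0 => x y; rewrite !inE negb_and negbK => /andP[xX xQ] /orP[yX|yQ].
    by rewrite h_sym noX.
  exact: noQ.
by rewrite leqn0 cards_eq0 => /eqP/setP/(_ u); rewrite !inE uX uQ.
Qed.

End RegularBarrier.

(** * Packing perfect matchings in expanding graphs *)

Section Packing.
Variables (T : finType) (e : rel T) (d : nat).
Hypotheses (simple_e : simple_graph e) (reg_e : regular_graph e d).

Let e_sym : symmetric e. Proof. by case: simple_e. Qed.
Let e_irr : irreflexive e. Proof. by case: simple_e. Qed.

(** Perfect matchings are encoded as involutions, so that they are disjoint
    exactly when they differ at every vertex. *)
Definition packing m (M : 'I_m -> T -> T) : Prop :=
  (forall i x, M i (M i x) = x /\ e x (M i x)) /\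
  (forall i j x, M i x = M j x -> i = j).

Definition leftover m (M : 'I_m -> T -> T) : rel T :=
  [rel x y | e x y && [forall i, M i x != y]].

(** The inequality e(X) >= 3/2 k |X| (n - |X|) / n, cleared of denominators. *)
Definition expanding (k : nat) : Prop := forall X : {set T},
  3 * k * (#|X| * (#|T| - #|X|)) <= 2 * #|T| * cut e X (~: X).

Section Leftover.
Variables (m : nat) (M : 'I_m -> T -> T).
Hypothesis packM : packing M.

Lemma leftover_sym : symmetric (leftover M).
Proof.
have [MP _] := packM => x y; rewrite /leftover /= e_sym; congr (_ && _).
apply: eq_forallb => i; congr (~~ _).
by apply/eqP/eqP => <-; have [] := MP i x; have [] := MP i y.
Qed.

Lemma leftover_irr : irreflexive (leftover M).
Proof. by move=> x; rewrite /leftover /= e_irr. Qed.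

Lemma edge_leftover x y :
  e x y -> leftover M x y || (y \in [set M i x | i : 'I_m]).
Proof.
move=> exy; rewrite /leftover /= exy /=.
case: (boolP [forall i, M i x != y]) => //= /forallPn[i /negPn/eqP <-].
by apply/imsetP; exists i.
Qed.

Lemma leftover_reg : regular_graph (leftover M) (d - m).
Proof.
have [MP Minj] := packM => x; rewrite -(reg_e x).
have -> : [set y | leftover M x y] = [set y | e x y] :\: [set M i x | i : 'I_m].
  apply/setP => y; rewrite in_setD !in_set /leftover /= andbC; congr (_ && _).
  apply/forallP/negP => [nM /imsetP[i _ yE]|nM i].
    by have := nM i; rewrite yE eqxx.
  by apply/eqP => yE; apply: nM; apply/imsetP; exists i.
rewrite cardsD (setIidPr _); last first.
  by apply/subsetP => _ /imsetP[i _ ->]; rewrite inE; have [] := MP i x.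
by rewrite card_imset ?card_ord // => i j; apply: Minj.
Qed.

(** Each removed matching takes at most one leaving edge per vertex of X. *)
Lemma cut_leftover (X : {set T}) :
  cut e X (~: X) <= cut (leftover M) X (~: X) + m * #|X|.
Proof.
apply: (cut_le_add (N := fun x => [set M i x | i : 'I_m])) => [x y _ _|x].
  exact: edge_leftover.
by apply: leq_trans (leq_imset_card _ _) _; rewrite card_ord.
Qed.

End Leftover.

Lemma packing_extend m (M : 'I_m -> T -> T) (f : T -> T) : packing M ->
  involutive f -> (forall x, leftover M x (f x)) ->
  exists M' : 'I_m.+1 -> T -> T, packing M'.
Proof.
move=> [MP Minj] fK fM.
exists (fun j => if unlift ord0 j is Some i then M i else f); split.
  move=> j x; case: unliftP => [i _|_]; first exact: MP.
  by rewrite fK; have /andP[] := fM x.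
have Mf i x : M i x <> f x by have /andP[_ /forallP/(_ i)/eqP] := fM x.
move=> i j x; case: unliftP => [i' ->|->]; case: unliftP => [j' ->|->] //.
- by move=> /Minj ->.
- by move/Mf.
- by move/esym/Mf.
Qed.

Section Exchange.
Variables (m : nat) (M : 'I_m -> T -> T).
Hypotheses (packM : packing M) (T_even : ~~ odd #|T|) (T_ge4 : 4 <= #|T|).
Hypothesis exp_e : expanding m.+1.

Lemma expanding_small (X : {set T}) : 3 * #|X| <= #|T| ->
  m.+1 * #|X| <= cut e X (~: X).
Proof.
move=> smallX; have := exp_e X.
have leX := max_card (mem X).
have T0 : 0 < #|T| by apply: leq_trans T_ge4.
move: smallX leX T0; clear.
move: #|X| #|T| (cut _ _ _) => x n c sm le n0 H.
rewrite -(leq_pmul2l (m := 2 * n)) ?muln_gt0 //; apply: leq_trans H.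
have -> : 3 * m.+1 * (x * (n - x)) = m.+1 * x * (3 * (n - x)) by lia.
by rewrite mulnC leq_mul2l; apply/orP; right; lia.
Qed.

Lemma expanding_small_strict (X : {set T}) : 0 < #|X| -> 3 * #|X| < #|T| ->
  m.+1 * #|X| < cut e X (~: X).
Proof.
move=> X_gt0 smallX; have := exp_e X.
have leX := max_card (mem X).
move: X_gt0 smallX leX; clear.
move: #|X| #|T| (cut _ _ _) => x n c x0 sm le H.
rewrite -(ltn_pmul2l (m := 2 * n)); last by lia.
apply: leq_trans H.
have -> : 3 * m.+1 * (x * (n - x)) = m.+1 * x * (3 * (n - x)) by lia.
by rewrite mulnC ltn_pmul2l ?muln_gt0 //; lia.
Qed.

Lemma leftover_expanding (N : 'I_m -> T -> T) (X : {set T}) : packing N ->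
  3 * #|X| <= #|T| -> #|X| <= cut (leftover N) X (~: X).
Proof.
move=> packN /expanding_small leX; rewrite -(leq_add2r (m * #|X|)) -mulSn.
exact: leq_trans leX (cut_leftover N X).
Qed.

(** Expansion of a single vertex shows that edges remain. *)
Lemma leftover_degree_gt0 : 0 < d - m.
Proof.
have /card_gt0P[x _] : 0 < #|T| by apply: leq_trans T_ge4.
have := leftover_expanding (X := [set x]) packM.
rewrite cards1 => /(_ (ltnW T_ge4)); rewrite /cut big_set1 => gt0.
apply: leq_trans gt0 _.
rewrite -(leftover_reg packM x); apply: subset_leq_card.
by apply/subsetP => y; rewrite !inE => /andP[].
Qed.

Definition splits (N : 'I_m -> T -> T) (Q : {set T}) : Prop :=
  [/\ odd #|Q|, #|T| < 3 * #|Q|, #|T| < 3 * #|~: Q|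
    & forall x y, x \in Q -> y \notin Q -> ~~ leftover N x y].

Lemma extend_or_splits (N : 'I_m -> T -> T) : packing N ->
  (exists M' : 'I_m.+1 -> T -> T, packing M') \/ exists Q, splits N Q.
Proof.
move=> packN.
have [[f fK fN]|] := perfect_or_split (leftover_sym packN) (@leftover_irr _ N)
  (leftover_reg packN) leftover_degree_gt0
  (fun X => leftover_expanding packN (X := X)) T_even; last by right.
by left; apply: packing_extend packN fK fN.
Qed.

(** Otherwise each M_i has at most one edge between the sides, so e(Q) <= m.
    Expansion makes e(Q) at least 3/2 (m + 1) |Q| |~: Q| / n, which is larger
    because both sides have more than n/3 vertices. *)
Lemma crossing_twice (Q : {set T}) : splits M Q ->
  exists i u u',
    [/\ u \in Q, u' \in Q, u != u', M i u \notin Q & M i u' \notin Q].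
Proof.
move=> [_ Q_large Qc_large noQ].
pose cross i := [set x in Q | M i x \notin Q].
suff [i /card_gt1P[u [u' [+ + nu]]]] : exists i, 1 < #|cross i|.
  by rewrite !inE => /andP[uQ u1] /andP[u'Q u'1]; exists i, u, u'.
case: (boolP [exists i, 1 < #|cross i|]) => [/existsP //|/existsPn le1].
exfalso.
have : cut e Q (~: Q) <= m.
  apply: (@leq_trans (\sum_(x in Q) \sum_i (M i x \notin Q))).
    apply: leq_sum => x xQ; rewrite -sum1_card.
    apply: (@leq_trans #|[set M i x | i in [pred i | M i x \notin Q]]|).
      rewrite sum1_card; apply: subset_leq_card; apply/subsetP => y.
      rewrite !inE => /andP[yQ /(edge_leftover M)/orP[hxy|/imsetP[i _ yE]]].
        by have := noQ _ _ xQ yQ; rewrite hxy.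
      by apply/imsetP; exists i => //; rewrite inE -yE.
    apply: leq_trans (leq_imset_card _ _) _; rewrite -sum1_card big_mkcond /=.
    by apply: leq_sum => i _; rewrite inE; case: (_ \in _).
  rewrite exchange_big /= -[X in _ <= X]card_ord -sum1_card.
  apply: leq_sum => i _.
  have := le1 i; rewrite -leqNgt; apply: leq_trans.
  rewrite -sum1_card big_mkcond [X in _ <= X]big_mkcond; apply: leq_sum => x _.
  by rewrite inE; case: (x \in Q); case: (M i x \in Q).
have := exp_e Q; have := cardsC Q.
move: Q_large Qc_large T_ge4; clear.
move: #|Q| #|~: Q| #|T| (cut _ _ _) => a b n c an bn n4 nE.
rewrite -{n}nE in an bn n4 *.
rewrite addKn => H cm.
(* From (3a - n)(3b - n) >= 0 with n = a + b. *)
have : 2 * ((a + b) * (a + b)) <= 9 * (a * b) by nia.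
nia.
Qed.

Lemma splitsC (N : 'I_m -> T -> T) (Q : {set T}) : packing N ->
  splits N Q -> splits N (~: Q).
Proof.
move=> packN [oQ Q1 Q2 noQ]; split; rewrite ?setCK //.
  by move: T_even oQ; rewrite -(cardsC Q) oddD => /[swap] ->; rewrite negbK.
move=> x y; rewrite !inE negbK => xQ yQ; rewrite (leftover_sym packN).
exact: noQ.
Qed.

(** The edge of M_i at u is joined to perfect matchings of Q minus u and of
    the complement of Q minus M_i u that lie in the leftover graph. *)
Lemma one_crossing_matching (Q : {set T}) (i : 'I_m) (u : T) : splits M Q ->
  u \in Q -> M i u \notin Q -> exists N : T -> T,
    [/\ involutive N, N u = M i u,
        forall x, N x = M i x \/ leftover M x (N x)
      & forall x, x \in Q -> x != u -> N x \in Q].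
Proof.
move=> splQ uQ; set w := M i u => wQ.
have near (A : {set T}) v : splits M A -> v \in A ->
    exists g : T -> T, forall x, x \in A -> x != v ->
      [/\ g (g x) = x, leftover M x (g x), g x \in A & g x != v].
  move=> [oA _ A2 noA] vA.
  have [g /pairingP pg ng] := split_factor_critical (leftover_sym packM)
    (@leftover_irr _ M) (leftover_reg packM) leftover_degree_gt0
    (fun X => leftover_expanding packM (X := X)) oA A2 noA vA.
  exists g => x xA nxv; have [gK gx] := pg x.
  have /gx[hx _] : g x != x by apply: ng; rewrite !inE nxv.
  by rewrite !inE => /andP[].
have [MP _] := packM; have [Mwu euw] := MP i u.
have [g1 g1P] := near _ _ splQ uQ.
have wQc : w \in ~: Q by rewrite inE.
have [g2 g2P] := near _ _ (splitsC packM splQ) wQc.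
pose N x := if x == u then w else if x == w then u
            else if x \in Q then g1 x else g2 x.
have nuw : u != w by apply: contraNneq wQ => <-.
exists N; split=> [x||x|x xQ nxu].
- rewrite {2}/N; have [->|nxu] := eqVneq x u.
    by rewrite /N eq_sym (negPf nuw) eqxx.
  have [->|nxw] := eqVneq x w; first by rewrite /N eqxx.
  have [xQ|xQ] := boolP (x \in Q).
    have [gK _ gQ gu] := g1P _ xQ nxu.
    by rewrite /N (negPf gu) gQ gK; case: eqVneq => // gw; rewrite -gw gQ in wQ.
  have [||gK _ gQ gw] := g2P x; rewrite ?inE //.
  move: gQ; rewrite inE => gQ; rewrite /N (negPf gw) (negPf gQ) gK.
  by case: eqVneq => // gu; rewrite gu uQ in gQ.
- by rewrite /N eqxx.
- rewrite /N; have [->|nxu] := eqVneq x u; first by left.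
  have [->|nxw] := eqVneq x w; first by left; rewrite Mwu.
  right; have [xQ|xQ] := boolP (x \in Q); first by have [] := g1P _ xQ nxu.
  by have [] := g2P x; rewrite ?inE.
- rewrite /N (negPf nxu); case: eqVneq => // _; rewrite xQ.
  by have [] := g1P _ xQ nxu.
Qed.

(** When X is separated from the rest by the two splits together, an edge of e
    leaving X at x is absent from one of the leftover graphs of M and M', so it
    leads to one of the m + 1 vertices M_i x and N x.  Expansion forbids so few
    leaving edges for a nonempty X with fewer than n/3 vertices. *)
Lemma split_part_large (M' : 'I_m -> T -> T) (N : T -> T) (Q P X : {set T}) :
  packing M' -> splits M Q -> splits M' P ->
  (forall j x, M' j x = N x \/ exists i, M' j x = M i x) ->
  (forall x y, x \in X -> y \notin X ->
     ((x \in Q) != (y \in Q)) || ((x \in P) != (y \in P))) ->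
  0 < #|X| -> #|T| <= 3 * #|X|.
Proof.
move=> packM' splQ splP M'E sep X_gt0; rewrite leqNgt; apply/negP => smallX.
have := expanding_small_strict X_gt0 smallX; rewrite ltnNge => /negP; apply.
pose opts x := N x |: [set M i x | i : 'I_m].
have /leq_trans : cut e X (~: X) <=
    cut (fun _ _ => false) X (~: X) + m.+1 * #|X|.
  apply: (cut_le_add (N := opts)) => [x y xX|x]; last first.
    rewrite -add1n; apply: leq_trans (leq_card_setU _ _) _.
    by rewrite cards1 leq_add2l (leq_trans (leq_imset_card _ _)) ?card_ord.
  rewrite inE /= => /(sep _ _ xX) sepxy exy.
  have cross (m' : 'I_m -> T -> T) A : packing m' -> splits m' A ->
      (x \in A) != (y \in A) -> exists j, y = m' j x.
    move=> pm' spA nA.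
    have : ~~ leftover m' x y.
      have [_ _ _ noA] := spA; have [_ _ _ noA'] := splitsC pm' spA.
      have [xA|xA] := boolP (x \in A).
        by apply: noA => //; move: nA; rewrite xA; case: (y \in A).
      apply: noA'; rewrite !inE //.
      by move: nA; rewrite (negPf xA); case: (y \in A).
    have /orP[->//|/imsetP[j _ ->]] := edge_leftover m' exy.
    by exists j.
  rewrite !inE.
  case/orP: sepxy => [/(cross _ _ packM splQ)|/(cross _ _ packM' splP)] [j ->].
    by apply/orP; right; apply/imsetP; exists j.
  have [->|[i ->]] := M'E j x; first by rewrite eqxx.
  by apply/orP; right; apply/imsetP; exists i.
apply; rewrite /cut big1 // => x _; apply/eqP.
by rewrite cards_eq0; apply/eqP/setP => y; rewrite !inE andbF.
Qed.

(** One M_i is replaced by the matching N of [one_crossing_matching].  A second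
    split P would have to be the same split as Q, because neither side of Q is
    large enough to be cut by P into two parts of n/3 vertices.  But u' and its
    partner in M_i, a second crossing edge, are adjacent in the new leftover
    graph. *)
Lemma packing_of_split (Q : {set T}) :
  splits M Q -> exists M' : 'I_m.+1 -> T -> T, packing M'.
Proof.
move=> splQ; have [i [u [u' [uQ u'Q nu Mu Mu']]]] := crossing_twice splQ.
have [N [NK Nu N_or NQ]] := one_crossing_matching splQ uQ Mu.
have [MP Minj] := packM.
have Nj j x : j != i -> M j x <> N x.
  move=> nj; case: (N_or x) => [-> /Minj /eqP|]; first by rewrite (negPf nj).
  by move=> /andP[_ /forallP/(_ j)/eqP].
pose M' j := if j == i then N else M j.
have packM' : packing M'.
  split=> [j x|j k x]; rewrite /M'.
    case: eqVneq => _; last exact: MP.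
    rewrite NK; split=> //; case: (N_or x) => [->|/andP[] //].
    by have [] := MP i x.
  case: (eqVneq j i) => [->|nj]; case: (eqVneq k i) => [->|nk] //.
  - by move/esym/(Nj _ _ nk).
  - by move/(Nj _ _ nj).
  - exact: Minj.
have [//|[P splP]] := extend_or_splits packM'; exfalso.
have M'E j x : M' j x = N x \/ exists i, M' j x = M i x.
  by rewrite /M'; case: eqVneq => _; [left|right; exists j].
have large := split_part_large packM' splQ splP M'E.
(* P contains all of a side of Q or none of it, for otherwise that side has at
   least 2n/3 vertices and the other one at most n/3. *)
have uniform (A : {set T}) : #|T| < 3 * #|~: A| -> (A = Q \/ A = ~: Q) ->
    forall x y, x \in A -> y \in A -> x \in P -> y \in P.
  move=> A_small AQ x y xA yA xP; apply/negPn/negP => yP.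
  have sepA z t : z \in A -> t \notin A -> (z \in Q) != (t \in Q).
    by case: AQ => ->; rewrite ?inE; case: (z \in Q); case: (t \in Q).
  have : #|T| <= 3 * #|A :&: P|.
    apply: large => [z t|]; last by apply/card_gt0P; exists x; rewrite inE xA.
    rewrite !inE => /andP[zA zP]; rewrite negb_and zP => /orP[tA|->].
      by rewrite sepA.
    by rewrite orbT.
  have : #|T| <= 3 * #|A :\: P|.
    apply: large => [z t|]; last by apply/card_gt0P; exists y; rewrite inE yP.
    rewrite !inE => /andP[zP zA].
    rewrite negb_and negbK (negPf zP) => /orP[->|tA].
      by rewrite orbT.
    by rewrite sepA.
  have := cardsID P A; have := cardsC A; move: A_small; clear.
  move: #|A :&: P| #|A :\: P| #|A| #|~: A| #|T| => *; lia.
have [_ Q1 Q2 _] := splQ; have [_ P1 P2 noP] := splP.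
have [_ _ _ noP'] := splitsC packM' splP.
have edge : leftover M' u' (M i u').
  have [_ eu] := MP i u'; rewrite /leftover /= eu.
  apply/forallP => j; rewrite /M'.
  case: (eqVneq j i) => [_|nj].
    by apply: contraNneq Mu' => <-; apply: NQ => //; rewrite eq_sym.
  by apply/eqP => /Minj /eqP; rewrite (negPf nj).
have uniQ := uniform Q Q2 (or_introl erefl).
have uniQ' : forall x y, x \in ~: Q -> y \in ~: Q -> x \in P -> y \in P.
  by apply: uniform; [rewrite setCK|right].
have [p pP] : exists p, p \in P.
  by apply/card_gt0P; move: P1; case: #|P| => //; rewrite muln0.
have [q qP] : exists q, q \in ~: P.
  by apply/card_gt0P; move: P2; case: #|~: P| => //; rewrite muln0.
move: qP; rewrite inE => /negP; apply.
(* The remaining crossing edge puts both sides of Q on the same side of P. *)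
have same : (u' \in P) = (M i u' \in P).
  apply/idP/idP => [u'P|wP]; apply/negPn/negP => nP.
    by have := noP _ _ u'P nP; rewrite edge.
  have := noP' u' (M i u'); rewrite !inE nP wP edge => /(_ isT isT).
  by [].
have wQ' : M i u' \in ~: Q by rewrite inE.
have u'P : u' \in P.
  have [pQ|pQ] := boolP (p \in Q); first exact: uniQ pP.
  by rewrite same; apply: (uniQ' p) => //; rewrite inE.
have [qQ|qQ] := boolP (q \in Q); first exact: uniQ u'P.
by apply: (uniQ' (M i u')) => //; rewrite ?inE // -same.
Qed.

Lemma packing_step : exists M' : 'I_m.+1 -> T -> T, packing M'.
Proof.
have [//|[Q splQ]] := extend_or_splits packM.
exact: packing_of_split splQ.
Qed.

End Exchange.

Theorem expanding_packing k : ~~ odd #|T| -> 4 <= #|T| -> expanding k ->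
  exists M : 'I_k -> T -> T, packing M.
Proof.
move=> T_even T_ge4.
elim: k => [_|k IH exp_k].
  by exists (fun _ x => x); split=> [] [].
have [|M packM] := IH; last exact: (packing_step packM).
move=> X; apply: leq_trans (exp_k X).
by rewrite leq_mul2r leq_mul2l leqnSn /= orbT.
Qed.

End Packing.

(** * The second eigenvalue bounds the edge expansion *)

Section Spectral.
Local Open Scope ring_scope.
Local Open Scope sesquilinear_scope.

Variable R : realType.
Local Notation C := (complex R).
Local Notation toC := (real_complex R).
Local Notation cplx := (map_mx toC).

Lemma conj_toC (x : R) : (toC x)^* = toC x.
Proof. by apply/CrealP; rewrite complex_real. Qed.

Lemma trmxC_toC m n (A : 'M[R]_(m, n)) : (cplx A) ^t* = cplx A^T.
Proof. by apply/matrixP => i j; rewrite !mxE conj_toC. Qed.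

(** A real symmetric matrix is Hermitian over the complex numbers, hence unitarily
    diagonalizable with real eigenvalues. *)
Lemma symmetric_diagonalization n (A : 'M[R]_n) : A^T = A ->
  exists (P : 'M[C]_n) (r : 'rV[R]_n),
    P \is unitarymx /\ cplx A = P ^t* *m diag_mx (cplx r) *m P.
Proof.
move=> symA.
have hermA : (cplx A) \is hermsymmx.
  by apply/is_hermitianmxP; rewrite expr0 scale1r trmxC_toC symA.
have := hermitian_normalmx hermA => /orthomx_spectralP.
set P := spectralmx _; set sp := spectral_diag _ => eqA.
exists P, (map_mx (@complex.Re R) sp); split; first exact: spectral_unitarymx.
rewrite -invmx_unitary ?spectral_unitarymx // -map_mx_comp.
suff -> : map_mx (toC \o @complex.Re R) sp = sp by [].
apply/matrixP => i j; rewrite !mxE /= RRe_real //.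
by have /mxOverP := hermitian_spectral_diag_real hermA; apply.
Qed.

Lemma char_poly_conj (F : fieldType) n (P B : 'M[F]_n) : P \in unitmx ->
  char_poly (invmx P *m B *m P) = char_poly B.
Proof.
move=> Pu; rewrite /char_poly /char_poly_mx !map_mxM /=.
set Q := map_mx polyC P; set Q' := map_mx polyC (invmx P).
have Q'Q : Q' *m Q = 1%:M by rewrite -map_mxM /= mulVmx // map_mx1.
have -> : 'X%:M - Q' *m map_mx polyC B *m Q =
          Q' *m ('X%:M - map_mx polyC B) *m Q.
  by rewrite mulmxBr mulmxBl scalar_mxC -[_ *m Q' *m Q]mulmxA Q'Q mulmx1.
by rewrite !det_mulmx mulrAC -det_mulmx Q'Q det1 mul1r.
Qed.

Lemma char_poly_diagonalization n (A : 'M[R]_n) (P : 'M[C]_n) (r : 'rV[R]_n) :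
  P \is unitarymx -> cplx A = P ^t* *m diag_mx (cplx r) *m P ->
  char_poly A = \prod_i ('X - (r 0 i)%:P).
Proof.
move=> uP eqA; apply: (@map_poly_inj _ _ toC).
rewrite map_char_poly eqA -invmx_unitary // char_poly_conj ?unitarymx_unit //.
rewrite char_poly_trig ?diag_mx_is_trig // rmorph_prod /=.
apply: eq_bigr => i _; rewrite rmorphB /= map_polyX map_polyC /=.
by rewrite !mxE eqxx mulr1n.
Qed.

(** The special case of the Courant-Fischer principle in which one of the two
    test vectors is an eigenvector.  Some nonzero combination g of u and v has
    no component along the eigenvector of the largest root r_i0.  The form of
    A - b is nonnegative at g, as u contributes a nonnegative multiple of a - b
    and v contributes nothing; but in the eigenbasis it is a combination with
    weights r_i - b, i <> i0, which are all negative if the second root is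
    below b. *)
Lemma second_eigenvalue_ge n (A : 'M[R]_n) (u v : 'rV[R]_n) (a b : R) :
  (1 < n)%N -> A^T = A -> u *m A = a *: u -> u != 0 -> v != 0 ->
  u *m v^T = 0 -> v *m A *m v^T = b *: (v *m v^T) -> b <= a ->
  b <= (eigenvalues A)`_1.
Proof.
move=> n_gt1 symA uA u0 v0 uv vAv le_ba.
have [P [r [uP eqA]]] := symmetric_diagonalization symA.
pose ge_r : rel 'I_n := fun i j => r 0 j <= r 0 i.
pose t := sort ge_r (enum 'I_n).
have tot : total ge_r by move=> i j; apply: le_total.
have sorted_t : sorted ge_r t by apply: sort_sorted.
have perm_t : perm_eq t (enum 'I_n) by rewrite perm_sort.
have -> : eigenvalues A = [seq r 0 i | i <- t].
  apply: eigenvaluesE; first by rewrite sorted_map.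
  rewrite (char_poly_diagonalization uP eqA) big_map (perm_big _ perm_t) /=.
  by rewrite big_enum.
have uniq_t : uniq t by rewrite (perm_uniq perm_t) enum_uniq.
have mem_t i : i \in t by rewrite (perm_mem perm_t) mem_enum.
have : size t = n by rewrite (perm_size perm_t) size_enum_ord.
case: t sorted_t uniq_t mem_t {perm_t} => [|i0 [|i1 t]];
  try by move=> _ _ _ szt; rewrite -szt in n_gt1.
move=> /= /andP[_ sorted_t] /andP[_ _] mem_t _.
rewrite leNgt; apply/negP => lt_b.
have r_lt i : i != i0 -> r 0 i < b.
  move=> ni; apply: le_lt_trans lt_b; have := mem_t i.
  rewrite !inE (negPf ni) /= => /orP[/eqP->//|it].
  have tr : transitive ge_r by move=> y x z yx zy; exact: le_trans zy yx.
  by have /allP/(_ _ it) := order_path_min tr sorted_t.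
pose z (g : 'rV[C]_n) := g *m P^t*.
have [al [be [gn0 gi0]]] : exists al be : C,
    al *: cplx u + be *: cplx v != 0 /\
    z (al *: cplx u + be *: cplx v) 0 i0 = 0.
  have [p0|p0] := eqVneq (z (cplx u) 0 i0) 0.
    by exists 1, 0; rewrite scale1r scale0r addr0 map_mx_eq0.
  exists (- (z (cplx v) 0 i0 / z (cplx u) 0 i0)), 1; split.
    apply/eqP => /(congr1 (mulmx^~ (cplx v^T))).
    rewrite mulmxDl -!scalemxAl -!map_mxM uv map_mx0 scaler0 add0r scale1r.
    rewrite mul0mx => /eqP; rewrite map_mx_eq0 => /eqP/matrixP/(_ 0 0).
    rewrite !mxE => /eqP.
    rewrite psumr_eq0 => [/allP vz|i _]; last by rewrite mxE -expr2 sqr_ge0.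
    case/eqP: v0; apply/rowP => i; have := vz i (mem_index_enum i).
    by rewrite !mxE mulf_eq0 orbb => /eqP.
  rewrite /z mulmxDl -!scalemxAl -!/(z _) !mxE mul1r mulNr divfK; last first.
    by move: p0; rewrite /z mxE.
  by rewrite addrC subrr.
set g := al *: cplx u + be *: cplx v in gn0 gi0.
have PP : P^t* *m P = 1%:M by rewrite -invmx_unitary // mulVmx ?unitarymx_unit.
have form : (g *m cplx (A - b%:M) *m g^t*) 0 0 =
    \sum_i toC (r 0 i - b) * (z g 0 i * (z g 0 i)^*).
  have -> : cplx (A - b%:M) = P^t* *m diag_mx (cplx (r - const_mx b)) *m P.
    rewrite map_mxB map_scalar_mx eqA /= map_mxB map_const_mx raddfB /=.
    rewrite diag_const_mx mulmxBr mulmxBl scalar_mxC.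
    by rewrite -[_ *m P^t* *m P]mulmxA PP mulmx1.
  have -> : g *m (P^t* *m diag_mx (cplx (r - const_mx b)) *m P) *m g^t* =
            z g *m diag_mx (cplx (r - const_mx b)) *m (z g)^t*.
    by rewrite /z trmx_mul map_mxM trmxCK !mulmxA.
  rewrite mul_mx_diag mxE; apply: eq_bigr => i _.
  rewrite [X in X * _]mxE [X in _ * X]mxE [X in X^*]mxE [X in _ * X * _]mxE.
  have -> : (r - const_mx b) 0 i = r 0 i - b by rewrite !mxE.
  by rewrite -mulrA mulrCA.
have val : (g *m cplx (A - b%:M) *m g^t*) 0 0 =
    al * al^* * toC ((a - b) * (u *m u^T) 0 0).
  have uAb : u *m (A - b%:M) = (a - b) *: u.
    by rewrite mulmxBr uA mul_mx_scalar scalerBl.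
  have vAbv : v *m (A - b%:M) *m v^T = 0.
    by rewrite mulmxBr mulmxBl vAv mul_mx_scalar -scalemxAl subrr.
  have vAbu : v *m (A - b%:M) *m u^T = 0.
    apply: trmx_inj; rewrite !trmx_mul trmxK trmx0 linearB /= symA tr_scalar_mx.
    by rewrite mulmxA uAb -scalemxAl uv scaler0.
  have uAbv : u *m (A - b%:M) *m v^T = 0 by rewrite uAb -scalemxAl uv scaler0.
  have -> : g^t* = al^* *: cplx u^T + be^* *: cplx v^T.
    by rewrite /g linearD /= !linearZ /= map_mxD !map_mxZ !trmxC_toC.
  rewrite /g mulmxDl !mulmxDr !mulmxDl -!scalemxAl -!scalemxAr -!map_mxM.
  rewrite vAbv vAbu uAbv !map_mx0 !scaler0 !addr0 scalerA.
  by rewrite uAb -scalemxAl !mxE.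
have sq_ge0 (w : C) : 0 <= w * w^* by apply: mul_conjC_ge0.
have uu_ge0 : 0 <= (u *m u^T) 0 0.
  by rewrite mxE sumr_ge0 // => i _; rewrite mxE -expr2 sqr_ge0.
have term_le0 i : toC (r 0 i - b) * (z g 0 i * (z g 0 i)^*) <= 0.
  have [->|ni] := eqVneq i i0; first by rewrite gi0 mul0r mulr0.
  by rewrite mulr_le0_ge0 // lecR subr_le0 ltW ?r_lt.
have sum0 : \sum_i toC (r 0 i - b) * (z g 0 i * (z g 0 i)^*) = 0.
  apply/le_anti/andP; split; first by rewrite sumr_le0.
  by rewrite -form val mulr_ge0 // lecR mulr_ge0 // subr_ge0.
case/eqP: gn0; suff : z g = 0.
  by move=> /(congr1 (mulmx^~ P)); rewrite /z -mulmxA PP mulmx1 mul0mx.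
apply/rowP => i; rewrite [RHS]mxE.
have [->|ni] := eqVneq i i0; first exact: gi0.
move: sum0 => /eqP; rewrite -oppr_eq0 -sumrN psumr_eq0; last first.
  by move=> j _; rewrite oppr_ge0.
move=> /allP/(_ i (mem_index_enum i)).
rewrite /= oppr_eq0 !mulf_eq0 conjC_eq0 orbb.
by case/orP => /eqP // /complexI /eqP; rewrite subr_eq0 lt_eqF // r_lt.
Qed.

End Spectral.

Section Expansion.
Local Open Scope ring_scope.

Variables (R : realType) (T : finType) (e : rel T) (d : nat).
Hypotheses (simple_e : simple_graph e) (reg_e : regular_graph e d).

Let e_sym : symmetric e. Proof. by case: simple_e. Qed.

Lemma sum_enum_val (F : T -> R) : \sum_(i < #|T|) F (enum_val i) = \sum_x F x.
Proof.
rewrite (reindex (enum_val : 'I_#|T| -> T)) //.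
exact/onW_bij/enum_val_bij.
Qed.

Lemma sum_neighbors (x : T) : \sum_y (e x y)%:R = d%:R :> R.
Proof.
rewrite -natr_sum; congr _%:R.
rewrite -(reg_e x) -sum1_card [RHS]big_mkcond /=.
by apply: eq_bigr => y _; rewrite inE; case: (e x y).
Qed.

Lemma sum_indicator (A : {set T}) : \sum_x (x \in A)%:R = #|A|%:R :> R.
Proof.
rewrite -natr_sum; congr _%:R; rewrite -sum1_card [RHS]big_mkcond /=.
by apply: eq_bigr => x _; case: (x \in A).
Qed.

Lemma adjacency_sym : (adjacency R e)^T = adjacency R e.
Proof. by apply/matrixP => i j; rewrite !mxE e_sym. Qed.

(** Compare both sides of the eigenvalue equation at an entry of largest
    modulus. *)
Lemma lambda2_le_degree : lambda2 R e <= d%:R.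
Proof.
rewrite /lambda2; set s := eigenvalues _.
have [le_s|lt_s] := leqP (size s) 1; first by rewrite nth_default ?ler0n.
have : s`_1 \in s by rewrite mem_nth.
rewrite {2}/s mem_sort => /flattenP[_ /mapP[x xr ->]] /nseqP[-> _].
have p0 : char_poly (adjacency R e) != 0 by exact/monic_neq0/char_poly_monic.
have : x \in rootsR (char_poly (adjacency R e)) by [].
rewrite -(roots_on_rootsR p0) in_itv /= -eigenvalue_root_char.
move=> /eigenvalueP[v vA v0].
have [i vi] : exists i, v 0 i != 0.
  apply/existsP; apply: contraNT v0 => /existsPn v0.
  by apply/eqP/rowP => i; rewrite mxE; apply/eqP/negPn.
case: (@arg_maxP _ _ _ i xpredT (fun k => `|v 0 k|) isT) => j _ vj.
have vj_gt0 : 0 < `|v 0 j| by apply: lt_le_trans (vj i isT); rewrite normr_gt0.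
apply: le_trans (ler_norm x) _; rewrite -(ler_pM2r vj_gt0) -normrM.
have -> : x * v 0 j = \sum_k v 0 k * (e (enum_val k) (enum_val j))%:R.
  have /rowP/(_ j) := vA; rewrite !mxE => <-.
  by apply: eq_bigr => k _; rewrite mxE.
apply: le_trans (ler_norm_sum _ _ _) _.
rewrite -(sum_neighbors (enum_val j)) -sum_enum_val mulr_suml.
apply: ler_sum => k _; rewrite normrM normr_nat mulrC [e (enum_val k) _]e_sym.
by apply: ler_wpM2l; [rewrite ler0n|exact: vj].
Qed.

(** Apply [second_eigenvalue_ge] to the all-ones vector and v = n 1_A - |A| 1.
    Here v . v = n |A| (n - |A|), and the form of d - A at v is the sum of the
    squares of the differences of v along the edges, that is n^2 e(A). *)
Lemma edge_expansion (A : {set T}) :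
  (d%:R - lambda2 R e) * (#|A|%:R * (#|T|%:R - #|A|%:R)) <=
    #|T|%:R * (cut e A (~: A))%:R.
Proof.
set n : R := #|T|%:R; set a : R := #|A|%:R.
pose ind x : R := (x \in A)%:R.
pose F x : R := n * ind x - a.
have ind2 x : ind x * ind x = ind x.
  by rewrite /ind; case: (x \in A); rewrite ?mulr1 ?mulr0.
have sum_ind : \sum_x ind x = a by exact: sum_indicator.
have sum1 : \sum_(x : T) 1 = n :> R by rewrite sumr_const.
have cutE : (cut e A (~: A))%:R =
    \sum_x \sum_y (e x y)%:R * (ind x * (1 - ind y)).
  rewrite /cut natr_sum big_mkcond /=; apply: eq_bigr => x _.
  rewrite /ind; case: (x \in A); last first.
    by rewrite big1 // => y _; rewrite mul0r mulr0.
  rewrite -sum1_card natr_sum big_mkcond /=; apply: eq_bigr => y _.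
  rewrite !inE; case: (y \in A); case: (e x y);
    by rewrite ?(mulr0, mulr1, mul1r, mul0r, subrr, subr0).
have FF : \sum_x F x * F x = n * (a * (n - a)).
  have -> : \sum_x F x * F x = \sum_x ((n * n - 2 * n * a) * ind x + a * a * 1).
    apply: eq_bigr => x _; rewrite /F.
    transitivity (n * n * (ind x * ind x) - 2 * n * a * ind x + a * a).
      by ring.
    by rewrite ind2; ring.
  by rewrite big_split /= -!mulr_sumr sum_ind sum1; ring.
have sumF : \sum_x F x = 0.
  rewrite (eq_bigr (fun x => n * ind x - a * 1)); last first.
    by move=> x _; rewrite /F mulr1.
  by rewrite sumrB -!mulr_sumr sum_ind sum1; ring.
have cross : \sum_x \sum_y (e x y)%:R * ind x =
             \sum_x \sum_y (e x y)%:R * ind y.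
  rewrite exchange_big /=; apply: eq_bigr => x _; apply: eq_bigr => y _.
  by rewrite e_sym.
have form : d%:R * (\sum_x F x * F x) - \sum_x \sum_y F x * (e x y)%:R * F y =
            n * n * (cut e A (~: A))%:R.
  rewrite mulr_sumr -sumrB.
  transitivity (\sum_x \sum_y (n * n * ((e x y)%:R * (ind x * (1 - ind y)))
      + (a * n * ((e x y)%:R * ind y) - a * n * ((e x y)%:R * ind x)))).
    apply: eq_bigr => x _; rewrite -(sum_neighbors x) mulr_suml -sumrB.
    apply: eq_bigr => y _; rewrite /F.
    transitivity ((e x y)%:R * (n * n * (ind x * ind x) - n * n * ind x * ind y
                                + a * n * (ind y - ind x))); first by ring.
    by rewrite ind2; ring.
  under eq_bigr do rewrite big_split sumrB -!mulr_sumr /=.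
  by rewrite big_split sumrB -!mulr_sumr /= cross subrr addr0 cutE.
have n_ge_a : a <= n by rewrite ler_nat max_card.
have [->|a_n0] := eqVneq (a * (n - a)) 0.
  by rewrite mulr0 mulr_ge0 ?ler0n.
have a_ge0 : 0 <= a by rewrite ler0n.
have an_gt0 : 0 < a * (n - a) by rewrite lt0r a_n0 mulr_ge0 ?subr_ge0.
have n_gt0 : 0 < n.
  rewrite lt0r ler0n andbT; apply: contraNneq a_n0 => n0.
  by have -> : a = 0; [lra|rewrite mul0r].
have n_gt1 : (1 < #|T|)%N.
  rewrite ltnNge; apply/negP => le1; case/negP: a_n0.
  have : (#|A| <= #|T|)%N by exact: max_card.
  rewrite /a /n; case: #|T| le1 => [|[|//]] _; case: #|A| => [|[|//]] // _;
    by rewrite ?subrr ?mul0r ?mulr0.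
pose u : 'rV[R]_#|T| := const_mx 1.
pose v : 'rV[R]_#|T| := \row_i F (enum_val i).
have uA : u *m adjacency R e = d%:R *: u.
  apply/rowP => j; rewrite !mxE mulr1.
  rewrite -(sum_neighbors (enum_val j)) -sum_enum_val.
  by apply: eq_bigr => i _; rewrite !mxE mul1r e_sym.
have uv : u *m v^T = 0.
  apply/matrixP => i j; rewrite !mxE -[RHS]sumF -sum_enum_val.
  by apply: eq_bigr => k _; rewrite !mxE mul1r.
have vv : v *m v^T = (n * (a * (n - a)))%:M.
  apply/matrixP => i j; rewrite !ord1 !mxE eqxx mulr1n -FF -sum_enum_val.
  by apply: eq_bigr => k _; rewrite !mxE.
pose q := \sum_x \sum_y F x * (e x y)%:R * F y.
have vAv : v *m adjacency R e *m v^T = q%:M.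
  apply/matrixP => i j; rewrite !ord1 !mxE eqxx mulr1n /q exchange_big /=.
  rewrite -sum_enum_val.
  apply: eq_bigr => k _; rewrite !mxE mulr_suml -sum_enum_val.
  by apply: eq_bigr => l _; rewrite !mxE.
have vv_gt0 : 0 < n * (a * (n - a)) by rewrite mulr_gt0.
have u0 : u != 0.
  apply/eqP => /rowP/(_ (Ordinal (ltnW n_gt1))); rewrite !mxE => /eqP.
  by rewrite oner_eq0.
have v0 : v != 0.
  apply/eqP => v0; move: vv; rewrite v0 mul0mx => /matrixP/(_ 0 0).
  rewrite !mxE /= mulr1n => /eqP.
  by rewrite lt_eqF.
pose b := q / (n * (a * (n - a))).
have qE : q = b * (n * (a * (n - a))) by rewrite divfK // gt_eqF.
have cut_ge0 : 0 <= (cut e A (~: A))%:R :> R by rewrite ler0n.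
have vAv' : v *m adjacency R e *m v^T = b *: (v *m v^T).
  by rewrite vAv vv scale_scalar_mx -qE.
move: form; rewrite FF -/q => form.
have le_bd : b <= d%:R.
  rewrite -(ler_pM2r vv_gt0) -qE -subr_ge0 form !mulr_ge0 // ltW.
have := second_eigenvalue_ge n_gt1 adjacency_sym uA u0 v0 uv vAv' le_bd.
rewrite -/(lambda2 R e) => le_bl.
rewrite -(ler_pM2l n_gt0) [leRHS]mulrA -form qE -mulrBl.
by rewrite mulrCA ler_wpM2r ?(ltW vv_gt0) // lerD2l lerN2.
Qed.

End Expansion.

(** * From the spectral gap to perfect matchings *)

Section EdgeSets.
Variables (T : finType) (e : rel T).
Hypothesis e_irr : irreflexive e.

Definition pairs (f : T -> T) : {set {set T}} := [set [set x; f x] | x : T].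

Lemma pair_eq (f : T -> T) x z : involutive f -> z \in [set x; f x] ->
  [set x; f x] = [set z; f z].
Proof.
by move=> fK; rewrite !inE => /orP[]/eqP-> //; rewrite fK setUC.
Qed.

Lemma perfect_matching_pairs (f : T -> T) :
  involutive f -> (forall x, e x (f x)) -> perfect_matching e (pairs f).
Proof.
move=> fK fe; split; last first.
  move=> x; exists [set x; f x]; last by rewrite !inE eqxx.
  by apply/imsetP; exists x.
split.
  apply/subsetP => _ /imsetP[x _ ->].
  by apply/imsetP; exists (x, f x); rewrite ?inE.
apply/trivIsetP => _ _ /imsetP[x _ ->] /imsetP[y _ ->].
apply: contraR; rewrite -setI_eq0 => /set0Pn[z].
by rewrite inE => /andP[/(pair_eq fK)-> /(pair_eq fK)->].
Qed.

Lemma disjoint_pairs (f g : T -> T) : involutive f -> involutive g ->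
  (forall x, e x (f x)) -> (forall x, f x <> g x) ->
  [disjoint pairs f & pairs g].
Proof.
move=> fK gK fe fg; rewrite -setI_eq0; apply/set0Pn => -[E].
rewrite inE => /andP[/imsetP[x _ ->] /imsetP[y _ xy]].
have : f x \in [set x; g x].
  by rewrite -(pair_eq (x := y) gK) -xy !inE eqxx ?orbT.
rewrite !inE => /orP[/eqP fx|/eqP]; last exact: fg.
by have := fe x; rewrite fx e_irr.
Qed.

End EdgeSets.

Local Open Scope ring_scope.

Lemma spectral_gap_expanding (R : realType) (T : finType) (e : rel T)
    (d k : nat) :
  simple_graph e -> regular_graph e d ->
  k%:R <= 2 / 3 * (d%:R - lambda2 R e) -> expanding e k.
Proof.
move=> simple_e reg_e le_k X.
have := edge_expansion R simple_e reg_e X.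
rewrite -(natrB _ (max_card (mem X))) -natrM -natrM => le_cut.
rewrite -(ler_nat R) -(mulnA 2) (natrM R 2) (natrM R (3 * k)).
set gap := d%:R - lambda2 R e in le_k le_cut *.
apply: le_trans (_ : 2 * (gap * (#|X| * (#|T| - #|X|))%:R) <= _).
  by rewrite mulrA ler_wpM2r // natrM; lra.
by rewrite ler_wpM2l.
Qed.

Theorem theorem1p3 (R : realType) (T : finType) (e : rel T) (d : nat)
    (d_ge3 : (3 <= d)%N) (simple_e : simple_graph e)
    (conn_e : connected_graph e) (reg_e : regular_graph e d)
    (even_T : ~~ odd #|T|) :
  exists (k : nat) (M : 'I_k -> {set {set T}}),
    [/\ k%:Z = Num.floor (2 / 3 * (d%:R - lambda2 R e)),
        forall i, perfect_matching e (M i)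
      & forall i j, i != j -> [disjoint M i & M j]].
Proof.
have [e_sym e_irr] := simple_e; have [T_gt0 _] := conn_e.
have gap_ge0 : 0 <= 2 / 3 * (d%:R - lambda2 R e).
  by have := lambda2_le_degree R simple_e reg_e; lra.
pose k := `|Num.floor (2 / 3 * (d%:R - lambda2 R e))|%N.
have kE : k%:Z = Num.floor (2 / 3 * (d%:R - lambda2 R e)).
  by rewrite /k gez0_abs // floor_ge0.
have T_ge4 : (4 <= #|T|)%N.
  have /card_gt0P[x _] := T_gt0.
  apply: leq_ltn_trans d_ge3 _; rewrite -(reg_e x).
  rewrite (cardD1 x predT) inE /= add1n ltnS; apply: subset_leq_card.
  apply/subsetP => y; rewrite !inE andbT.
  by apply: contraTneq => ->; rewrite e_irr.
have exp_k : expanding e k.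
  apply: (spectral_gap_expanding simple_e reg_e (R := R)).
  by rewrite pmulrn kE floor_le.
have [M [MP M_inj]] := expanding_packing simple_e reg_e even_T T_ge4 exp_k.
have MK i : involutive (M i) by move=> x; have [] := MP i x.
have Me i x : e x (M i x) by have [] := MP i x.
exists k, (fun i => pairs (M i)); split=> // [i|i j nij].
  exact: perfect_matching_pairs (MK i) (Me i).
apply: (disjoint_pairs e_irr) (MK i) (MK j) (Me i) _ => x /M_inj /eqP.
by rewrite (negPf nij).
Qed.
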